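(* Let $(X,T)$ be a dynamical system. If there exists a weakly mixing, fully supported $T$-invariant Borel probability measure $\mu$ on $X$, then there exists a Borel subset $X_0$ of $X$ with $\mu(X_0)=1$ such that for every $x\in X_0$, every $d\in\mathbb{N}$ and all non-empty open subsets $U_1,U_2,\dots,U_d$ of $X$ the set \[N_{T\times T^2\times\dots\times T^d}\bigl((x,x,\dots,x),U_1\times U_2\times\dots\times U_d\bigr)\] has positive upper density.
   Context: A (topological) dynamical system $(X,T)$ consists of a (nonempty) compact metric space and a continuous map $T\colon X\to X$. $\mathbb{N}$ is the set of positive integers. A measure is fully supported if its support (the smallest closed set of measure $1$) is $X$. Weakly mixing is meant in the usual measure-theoretic sense for the measure-preserving system $(X,\mathcal{B}(X),\mu,T)$, with $\mathcal B(X)$ the Borel $\sigma$-algebra. For a map $R\colon Z\to Z$, $z\in Z$ and $W\subset Z$, $N_R(z,W)=\{n\in\mathbb{N}: R^nz\in W\}$; so the set in the claim is $\{n\in\mathbb{N}: T^{in}x\in U_i\text{ for } i=1,\dots,d\}$. The upper density of a set $F$ of nonnegative integers is $\overline d(F)=\limsup_{n\to\infty}\#(F\cap[0,n-1])/n$. *)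

(* Defs.v *)
From HB Require Import structures.
From mathcomp Require Import all_boot all_order all_algebra.
From mathcomp Require Import all_classical all_reals all_analysis.

Set Implicit Arguments.
Unset Strict Implicit.
Unset Printing Implicit Defensive.

Import Order.TTheory GRing.Theory Num.Theory.
Import numFieldNormedType.Exports.

Local Open Scope classical_set_scope.
Local Open Scope ring_scope.

(* Nonemptiness is carried by the base point, which MathComp-Analysis requires
   of every measurable type; no definition below depends on its choice. *)
#[short(type="pmetricType")]
HB.structure Definition PointedMetric (R : numDomainType) :=
  { X of Metric R X & Pointed X }.

Notation borel X := (g_sigma_algebraType (@open X)).

Section measure_notions.
Context {R : realType} {X : pmetricType R}.
Implicit Types (mu : probability (borel X) R) (T : X -> X).

Definition invariant_measure T mu :=
  forall A : set (borel X), measurable A -> mu (T @^-1` A) = mu A.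

Definition weakly_mixing T mu :=
  forall A B : set (borel X), measurable A -> measurable B ->
  (fun N : nat => N%:R^-1 *
     \sum_(n < N) `| fine (mu (iter n T @^-1` A `&` B))
                     - fine (mu A) * fine (mu B) |) @ \oo --> (0 : R).

(* X is second countable whenever it is compact, and then this intersection has
   itself measure 1, so it is the smallest closed set of measure 1. *)
Definition measure_support mu : set X :=
  \bigcap_(F in [set F : set X | closed F /\ mu F = 1%E]) F.

Definition fully_supported mu := measure_support mu = setT.

End measure_notions.

(* For n = 0 the quotient is 0 / 0 = 0, which does not affect the limsup. *)
Definition upper_density (R : realType) (F : set nat) : \bar R :=
  limn_esup (fun n : nat =>
    (#|[pred k : 'I_n | (k : nat) \in F]|%:R / n%:R)%:E).

Definition return_times (Z : Type) (f : Z -> Z) (z : Z) (W : set Z) : set nat :=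
  [set n | (0 < n)%N /\ W (iter n f z)].

(* T x T^2 x ... x T^d on X^d = ('I_d -> X): index i : 'I_d stands for the
   coordinate i + 1. *)
Definition prod_powers (X : Type) (T : X -> X) (d : nat)
    (z : 'I_d -> X) : 'I_d -> X :=
  fun i => iter i.+1 T (z i).

Definition box (X : Type) (d : nat) (U : 'I_d -> set X) : set ('I_d -> X) :=
  [set z | forall i, U i (z i)].

(* Main.v *)
Require Import Defs.
From mathcomp Require Import all_boot all_order all_algebra.
From mathcomp Require Import all_classical all_reals all_analysis.
From mathcomp Require Import measurable_realfun.
From mathcomp Require Import ring lra zify.
Local Open Scope classical_set_scope.
Local Open Scope ring_scope.
Set Implicit Arguments.
Unset Strict Implicit.
Unset Printing Implicit Defensive.
Import Order.TTheory GRing.Theory Num.Theory.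
Import numFieldNormedType.Exports.

(** Weak mixing forces multiple mixing along arithmetic progressions
    (Furstenberg): for all bounded functions f0, ..., fk the Cesaro means in n
    of the integral of f0 * f1(T^n x) * ... * fk(T^(kn) x) tend to the product
    of the integrals of f0, ..., fk. This is [weakly_mixing_all_orders], stated
    for simple functions; they form an algebra stable under T, so the whole
    argument stays among them.

    The proof is by induction on k. Replacing the functions one at a time by
    their means reduces the claim to the case where some fj has mean zero, in
    which the limit must be 0. Writing u_n for the product of the fi(T^(in) x),
    van der Corput's inequality bounds the Cesaro means of the integrals of
    f0 * u_n by averages, over a long window of shifts h and l, of the limiting
    correlations of u_(n+h) with u_(n+l). Invariance removes one power of T
    from these correlations, so the induction hypothesis computes their limits:
    products over i of the correlations of fi(T^(ih) x) with fi(T^(il) x). The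
    factor of index j is the correlation of fj with fj(T^(j|h-l|) x), and weak
    mixing makes its average over h and l small. The function f0 enters van der
    Corput's inequality only through the positivity of the integral of the
    square of e f0 - u_n - ... - u_(n+H-1), so after integration only sequences
    of real numbers remain ([van_der_corput]).

    Weak convergence of the averages is enough for the pointwise statement.
    Take for f1, ..., fk the indicators of sets U1, ..., Uk, whose measures have
    a positive product c, and let E be the set of points whose frequency of
    joint visits stays below delta < c from some fixed time on. With f0 the
    indicator of E, the limit c mu(E) is at most delta mu(E), so E is null
    ([negligible_rare_visits]). Full support gives every nonempty open set
    positive measure, and since a compact metric space is second countable,
    only countably many null sets have to be discarded. *)

(** * Cesaro means and van der Corput's inequality *)

Section cesaro_means.
Context {R : realType}.
Implicit Types (a b : nat -> R) (c l : R).

Definition cesaro_mean a (N : nat) : R := N%:R^-1 * \sum_(n < N) a n.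

Lemma cesaro_meanD a b N :
  cesaro_mean (fun n => a n + b n) N = cesaro_mean a N + cesaro_mean b N.
Proof. by rewrite /cesaro_mean big_split mulrDr. Qed.

Lemma cesaro_meanZ c a N :
  cesaro_mean (fun n => c * a n) N = c * cesaro_mean a N.
Proof. by rewrite /cesaro_mean -mulr_sumr mulrCA. Qed.

Lemma cesaro_mean_sum m (a : 'I_m -> nat -> R) N :
  cesaro_mean (fun n => \sum_i a i n) N = \sum_i cesaro_mean (a i) N.
Proof. by rewrite /cesaro_mean exchange_big mulr_sumr. Qed.

Lemma le_cesaro_mean a b N :
  (forall n, a n <= b n) -> cesaro_mean a N <= cesaro_mean b N.
Proof.
by move=> ab; rewrite ler_wpM2l ?invr_ge0//; apply: ler_sum => i _; exact: ab.
Qed.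

Lemma le_cesaro_mean_cst a c N :
  0 <= c -> (forall n, a n <= c) -> cesaro_mean a N <= c.
Proof.
move=> c0 ac; case: N => [|N]; first by rewrite /cesaro_mean big_ord0 mulr0.
rewrite ler_pdivrMl// -[leRHS]mulrC.
apply: (le_trans (ler_sum _ (fun (i : 'I_N.+1) _ => ac i))).
by rewrite sumr_const card_ord mulr_natr.
Qed.

Lemma cvg_cesaro_mean_cst c : cesaro_mean (fun=> c) @ \oo --> c.
Proof.
apply/cvg_ballP => e e0; near=> N; rewrite /cesaro_mean sumr_const card_ord.
rewrite -[c *+ N]mulr_natr mulrCA mulVf ?mulr1; first exact: ballxx.
by rewrite pnatr_eq0 -lt0n; near: N; exact: nbhs_infty_gt.
Unshelve. all: by end_near. Qed.

Lemma cvg0_le (u v : nat -> R) :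
  (forall n, `|u n| <= v n) -> v @ \oo --> 0 -> u @ \oo --> 0.
Proof.
move=> uv v0; apply/norm_cvg0P; apply: (squeeze_cvgr _ (cvg_cst 0) v0).
by near=> n; rewrite normr_ge0 uv.
Unshelve. all: by end_near. Qed.

Lemma eq_cvg_cesaro_mean a b l : (forall n, a n = b n) ->
  cesaro_mean a @ \oo --> l -> cesaro_mean b @ \oo --> l.
Proof. by move=> /funext->. Qed.

Lemma cvg_cesaro_meanD a b l l' :
  cesaro_mean a @ \oo --> l -> cesaro_mean b @ \oo --> l' ->
  cesaro_mean (fun n => a n + b n) @ \oo --> l + l'.
Proof.
move=> al bl; have -> : cesaro_mean (fun n => a n + b n) =
    cesaro_mean a \+ cesaro_mean b by apply/funext => N; exact: cesaro_meanD.
exact: cvgD.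
Qed.

Lemma cvg_ord_sum m (u : 'I_m -> nat -> R) (l : 'I_m -> R) :
  (forall i, u i @ \oo --> l i) ->
  (fun n => \sum_i u i n) @ \oo --> \sum_i l i.
Proof.
move=> ul; apply: cvg_big => //; exact: add_continuous.
Qed.

Lemma cvg_cesaro_mean_norm_lin c a b :
  cesaro_mean (fun n => `|a n|) @ \oo --> 0 ->
  cesaro_mean (fun n => `|b n|) @ \oo --> 0 ->
  cesaro_mean (fun n => `|c * a n + b n|) @ \oo --> 0.
Proof.
move=> a0 b0; apply: (@cvg0_le _ (fun N =>
    `|c| * cesaro_mean (fun n => `|a n|) N +
    cesaro_mean (fun n => `|b n|) N)); last first.
  rewrite -[X in _ --> X]addr0 -{1}(mulr0 `|c|).
  by apply: cvgD b0; exact: cvgMl_tmp.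
move=> N; rewrite ger0_norm; last by rewrite mulr_ge0 ?invr_ge0 ?sumr_ge0.
rewrite -cesaro_meanZ -cesaro_meanD; apply: le_cesaro_mean => n.
by rewrite -normrM; exact: ler_normD.
Qed.

Lemma cvg_inv_nat : (fun N : nat => N%:R^-1 : R) @ \oo --> 0.
Proof.
by rewrite -(cvg_shiftS (fun N : nat => N%:R^-1 : R)); exact: cvg_harmonic.
Qed.

(** The two sums differ in at most 2h terms. *)
Lemma cesaro_mean_shift a C h : (forall n, `|a n| <= C) ->
  (fun N => cesaro_mean (fun n => a (n + h)%N) N - cesaro_mean a N) @ \oo --> 0.
Proof.
move=> aC.
apply: (@cvg0_le _ (fun N => N%:R^-1 * (h%:R * (2 * C)))); last first.
  rewrite -[X in _ --> X](mul0r (h%:R * (2 * C))).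
  by apply: cvgMr_tmp; exact: cvg_inv_nat.
move=> N; rewrite /cesaro_mean -mulrBr normrM ger0_norm ?invr_ge0//.
rewrite ler_wpM2l ?invr_ge0//; elim: h => [|h ih].
  under eq_bigr do rewrite addn0.
  by rewrite subrr normr0 mul0r.
have step : \sum_(i < N) a (i + h.+1)%N =
    \sum_(i < N) a (i + h)%N + (a (N + h)%N - a h).
  apply/eqP; rewrite addrC -subr_eq -sumrB; apply/eqP.
  under eq_bigr do rewrite addnS -addSn.
  rewrite -(big_mkord xpredT (fun i => a (i.+1 + h)%N - a (i + h)%N)).
  by rewrite (telescope_sumr (fun i => a (i + h)%N)).
rewrite step addrAC -natr1 mulrDl mul1r (le_trans (ler_normD _ _))// lerD//.
by rewrite mulr_natl mulr2n (le_trans (ler_normB _ _))// lerD.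
Qed.

(** The values along the multiples of j+1 are among all the values, so passing
    to them costs at most a factor j+1 in the mean. *)
Lemma cvg_cesaro_mean_dilate (phi : nat -> R) j : (forall n, 0 <= phi n) ->
  cesaro_mean phi @ \oo --> 0 ->
  cesaro_mean (fun n => phi (j.+1 * n)%N) @ \oo --> 0.
Proof.
move=> phi0 cphi.
have sub N : \sum_(n < N) phi (j.+1 * n)%N <= \sum_(m < j.+1 * N) phi m.
  elim: N => [|N ih]; first by rewrite muln0 !big_ord0.
  rewrite big_ord_recr/= mulnS addnC big_split_ord/= lerD//.
  by rewrite big_ord_recl/= addn0 ler_wpDr// sumr_ge0.
apply: (@cvg0_le _ (fun N => j.+1%:R * cesaro_mean phi (j.+1 * N)%N)).
  move=> N; rewrite ger0_norm; last by rewrite mulr_ge0 ?invr_ge0 ?sumr_ge0.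
  rewrite /cesaro_mean natrM invfM !mulrA mulfV ?pnatr_eq0// mul1r.
  by rewrite ler_wpM2l ?invr_ge0.
rewrite -[X in _ --> X](mulr0 j.+1%:R); apply: cvgMl_tmp.
apply: (@cvg_comp _ _ _ (fun N => j.+1 * N)%N (cesaro_mean phi) _ _ _ _ cphi).
apply/cvgnyPge => A; near=> N; rewrite (leq_trans _ (leq_pmull _ _))//.
by near: N; exact: nbhs_infty_ge.
Unshelve. all: by end_near. Qed.

(** Each difference |h - k|, written with truncated subtraction, occurs at most
    twice in every row of the square. *)
Lemma toeplitz_sum (phi : nat -> R) H : (forall n, 0 <= phi n) ->
  \sum_(h < H) \sum_(k < H) phi ((h - k) + (k - h))%N <=
  2 * H%:R * \sum_(l < H) phi l.
Proof.
move=> phi0.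
have row (h : nat) : (h < H)%N -> \sum_(k < H) phi ((h - k) + (k - h))%N <=
    2 * \sum_(l < H) phi l.
  move=> hH.
  have le_psum m : (m <= H)%N -> \sum_(l < m) phi l <= \sum_(l < H) phi l.
    move=> mH; rewrite -(subnK mH) addnC big_split_ord/= lerDl.
    exact: sumr_ge0.
  have left m : \sum_(k < m) phi (m - k)%N <= \sum_(l < m.+1) phi l.
    elim: m => [|m ih]; first by rewrite big_ord0 sumr_ge0.
    by rewrite big_ord_recl big_ord_recr/= addrC lerD.
  rewrite -[in leLHS](subnKC (ltnW hH)) big_split_ord/= mulrDl mul1r lerD//.
    apply: le_trans (le_psum _ hH); apply: le_trans (left h).
    by apply: ler_sum => k _; rewrite (eqP (ltnW (ltn_ord k))) addn0.
  apply: le_trans (le_psum _ (leq_subr h H)).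
  by apply: ler_sum => k _; rewrite subnDA subnn sub0n addKn.
apply: (le_trans (ler_sum _ (fun (h : 'I_H) _ => row h (ltn_ord h)))).
by rewrite sumr_const card_ord -[leLHS]mulr_natr mulrAC.
Qed.

(** Think of a n as the integral of f0 u_n, of b n m as that of u_n u_m, and of
    D as that of f0^2: the second hypothesis then expresses that the square of
    e f0 - u_n - ... - u_(n+H-1) has a nonnegative integral. Taking the mean
    over n and dividing by H^2 bounds the limit superior of 2 e times the means
    of a by e^2 D plus an average of g, which is small for large H. As e can be
    small and of either sign, the means of a tend to 0. *)
Lemma van_der_corput a (b g : nat -> nat -> R) (phi : nat -> R) (C D : R) :
  0 <= D ->
  (forall n, `|a n| <= C) ->
  (forall e H n, 2 * e * \sum_(h < H) a (n + h)%N <=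
     e ^+ 2 * D + \sum_(h < H) \sum_(k < H) b (n + h)%N (n + k)%N) ->
  (forall h k, cesaro_mean (fun n => b (n + h)%N (n + k)%N) @ \oo --> g h k) ->
  (forall h k, g h k <= phi ((h - k) + (k - h))%N) ->
  (forall n, 0 <= phi n) ->
  cesaro_mean phi @ \oo --> 0 ->
  cesaro_mean a @ \oo --> 0.
Proof.
move=> D0 aC dom cvgb gphi phi0 cphi.
have one_sided (e : R) : e != 0 -> \forall N \near \oo,
    2 * e * cesaro_mean a N <= e ^+ 2 * (D + 2).
  move=> e0; have e2 : 0 < e ^+ 2 by rewrite exprn_even_gt0.
  (* the window length H is chosen first; only then N tends to infinity *)
  have [H H0 phiH] : exists2 H, (0 < H)%N & 2 * cesaro_mean phi H < e ^+ 2.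
    have /cvgrPdist_lt /(_ (e ^+ 2 / 2)) := cphi.
    rewrite divr_gt0// => /(_ isT) near_phi.
    have [H [H0 phiH]] : exists H,
        (0 < H)%N /\ `|0 - cesaro_mean phi H| < e ^+ 2 / 2.
      near \oo => H; exists H; split; near: H; first exact: nbhs_infty_gt.
      exact: near_phi.
    exists H => //; move: phiH; rewrite sub0r normrN.
    by move=> /(le_lt_trans (ler_norm _)); lra.
  have HR0 : 0 < H%:R :> R by rewrite ltr0n.
  (* the error made in replacing the window average of a by a itself *)
  pose r N := 2 * e * (H%:R^-1 * \sum_(h < H)
     (cesaro_mean (fun n => a (n + h)%N) N - cesaro_mean a N)).
  have r0 : r @ \oo --> 0.
    rewrite -[X in _ --> X](mulr0 (2 * e)); apply: cvgMl_tmp.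
    rewrite -[X in _ --> X](mulr0 H%:R^-1); apply: cvgMl_tmp.
    rewrite [X in _ --> X](_ : _ = \sum_(h < H) (0 : R)); last by rewrite big1.
    apply: (@cvg_ord_sum _ (fun h N => cesaro_mean (fun n => a (n + h)%N) N -
      cesaro_mean a N)) => h; exact: (cesaro_mean_shift _ aC).
  pose s N := H%:R ^- 2 * \sum_(h < H) \sum_(k < H)
    cesaro_mean (fun n => b (n + h)%N (n + k)%N) N.
  have s_cvg : s @ \oo --> H%:R ^- 2 * \sum_(h < H) \sum_(k < H) g h k.
    apply: cvgMl_tmp; apply: (@cvg_ord_sum _ (fun h N => \sum_(k < H)
      cesaro_mean (fun n => b (n + h)%N (n + k)%N) N)) => h.
    by apply: (@cvg_ord_sum _ (fun k =>
      cesaro_mean (fun n => b (n + h)%N (n + k)%N))) => k; exact: cvgb.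
  have lim_s : H%:R ^- 2 * \sum_(h < H) \sum_(k < H) g h k < e ^+ 2.
    apply: le_lt_trans phiH; rewrite ler_pdivrMl ?exprn_gt0//.
    rewrite (le_trans (ler_sum _ (fun (h : 'I_H) _ =>
      ler_sum _ (fun (k : 'I_H) _ => gphi h k))))//.
    rewrite (le_trans (toeplitz_sum _ phi0))// /cesaro_mean.
    rewrite le_eqVlt; apply/orP; left; apply/eqP; field.
    by rewrite gt_eqF.
  have bound N : 2 * e * cesaro_mean a N <= e ^+ 2 * D + s N - r N.
    (* e is scaled by H because the windows are sums rather than averages *)
    have := @le_cesaro_mean _ _ N (dom (e * H%:R) H).
    rewrite cesaro_meanZ cesaro_mean_sum cesaro_meanD cesaro_mean_sum.
    under [X in _ <= _ + X]eq_bigr do rewrite cesaro_mean_sum.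
    rewrite /r /s sumrB sumr_const card_ord -[cesaro_mean a N *+ H]mulr_natr.
    set S := \sum_h _; set B := \sum_h _.
    have : cesaro_mean (fun=> (e * H%:R) ^+ 2 * D) N <= (e * H%:R) ^+ 2 * D.
      by apply: le_cesaro_mean_cst => //; rewrite mulr_ge0// sqr_ge0.
    move=> le_cst /le_trans/(_ (lerD le_cst (lexx B))) main.
    have H2 : 0 < H%:R ^+ 2 :> R by rewrite exprn_gt0.
    rewrite -(ler_pM2l H2) -subr_ge0; move: main; rewrite -subr_ge0.
    by congr (0 <= _); field; rewrite gt_eqF.
  near=> N; apply: (le_trans (bound N)).
  have rN : `|0 - r N| < e ^+ 2.
    by near: N; move/cvgrPdist_lt : r0; exact.
  have sN : s N < e ^+ 2.
    by near: N; exact: (cvgr_lt _ s_cvg).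
  move: rN; rewrite sub0r normrN => /ltr_normlP[]; lra.
apply/cvgrPdist_le => eps eps0.
(* so that e^2 (D + 2) = 2 e eps *)
pose e := 2 * eps / (D + 2).
have e0 : 0 < e by rewrite divr_gt0 ?mulr_gt0//; lra.
near=> N; rewrite sub0r normrN.
have hp : 2 * e * cesaro_mean a N <= e ^+ 2 * (D + 2).
  by near: N; apply: one_sided; rewrite gt_eqF.
have hn : 2 * - e * cesaro_mean a N <= (- e) ^+ 2 * (D + 2).
  by near: N; apply: one_sided; rewrite oppr_eq0 gt_eqF.
have De : e * (D + 2) = 2 * eps by rewrite divfK// gt_eqF//; lra.
have e20 : 0 < 2 * e by lra.
have e2 : e ^+ 2 * (D + 2) = e * (2 * eps) by rewrite expr2 -mulrA De.
rewrite ler_norml -(ler_pM2l e20) -[X in _ && X](ler_pM2l e20).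
move: hp hn; rewrite sqrrN e2 => hp hn; apply/andP; split; lra.
Unshelve. all: by end_near. Qed.

End cesaro_means.

(** * Simple functions and their means *)

Section simple_functions.
Context {R : realType} d {Y : measurableType d} (mu : probability Y R).
Implicit Types f g : Y -> R.

(** Generating the simple functions by linear combinations makes the statements
    that are (bi)linear in the functions provable by induction from the case of
    indicators, where they are statements about sets. *)
Inductive simple : (Y -> R) -> Prop :=
| simple_indic A : measurable A -> simple \1_A
| simple_lin c f g : simple f -> simple g -> simple (fun x => c * f x + g x).

Lemma simple_cst c : simple (fun=> c).
Proof.
have -> : (fun=> c) = (fun x : Y => c * \1_[set: Y] x + \1_(set0 : set Y) x).
  by apply/funext => x; rewrite indicT indic0 mulr1 addr0.
by apply: simple_lin; apply: simple_indic.
Qed.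

Lemma simpleZ c f : simple f -> simple (fun x => c * f x).
Proof.
move=> sf; under eq_fun do rewrite -[_ * _]addr0.
exact: simple_lin (simple_cst 0).
Qed.

Lemma simpleD f g : simple f -> simple g -> simple (fun x => f x + g x).
Proof.
by move=> sf sg; under eq_fun do rewrite -[f _]mul1r; exact: simple_lin.
Qed.

Lemma simpleM f g : simple f -> simple g -> simple (fun x => f x * g x).
Proof.
move=> sf sg; elim: sf => [A mA|c f1 f2 _ ih1 _ ih2]; last first.
  by under eq_fun do rewrite mulrDl -mulrA; exact: simple_lin.
elim: sg => [B mB|c g1 g2 _ ih1 _ ih2]; last first.
  by under eq_fun do rewrite mulrDr mulrCA; exact: simple_lin.
suff -> : (fun x => \1_A x * \1_B x) = \1_(A `&` B) :> (Y -> R).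
  exact/simple_indic/measurableI.
by rewrite indicI.
Qed.

Lemma simple_sum (I : Type) (s : seq I) (F : I -> Y -> R) :
  (forall i, simple (F i)) -> simple (fun x => \sum_(i <- s) F i x).
Proof.
move=> sF; elim: s => [|i s ih].
  by under eq_fun do rewrite big_nil; exact: simple_cst.
by under eq_fun do rewrite big_cons; exact: simpleD.
Qed.

Lemma simple_prod (I : Type) (s : seq I) (P : pred I) (F : I -> Y -> R) :
  (forall i, simple (F i)) -> simple (fun x => \prod_(i <- s | P i) F i x).
Proof.
move=> sF; elim: s => [|i s ih].
  by under eq_fun do rewrite big_nil; exact: simple_cst.
under eq_fun do rewrite big_cons; case: (P i) => //; exact: simpleM.
Qed.

Lemma simple_comp (S : Y -> Y) f :
  measurable_fun setT S -> simple f -> simple (fun x => f (S x)).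
Proof.
move=> mS; elim=> [A mA|c f1 f2 _ ih1 _ ih2]; last exact: simple_lin.
apply: (@simple_indic (S @^-1` A)).
by rewrite -[X in measurable X]setTI; exact: mS.
Qed.

Lemma simple_measurable f : simple f -> measurable_fun setT f.
Proof.
elim=> [A mA|c f1 f2 _ ih1 _ ih2]; first exact: measurable_indic.
by apply: measurable_funD => //; exact: measurable_funM.
Qed.

Lemma simple_bounded f : simple f -> exists M, forall x, `|f x| <= M.
Proof.
elim=> [A mA|c f1 f2 _ [M1 fM1] _ [M2 fM2]].
  by exists 1 => x; rewrite indicE ger0_norm// lern1 leq_b1.
exists (`|c| * M1 + M2) => x.
by rewrite (le_trans (ler_normD _ _))// lerD// normrM ler_wpM2l.
Qed.

Lemma simple_integrable f : simple f -> mu.-integrable setT (EFin \o f).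
Proof.
move=> sf; apply: measurable_bounded_integrable => //.
- by apply: (@le_lt_trans _ _ 1%E); [exact: probability_le1|exact: ltry].
- exact: simple_measurable.
have [M fM] := simple_bounded sf.
exists M; split; first exact: num_real.
by move=> z Mz x _; apply: le_trans (fM x) _; exact: ltW.
Qed.

Definition mean f : R := \int[mu]_x f x.

Lemma mean_indic A : measurable A -> mean \1_A = fine (mu A).
Proof. by move=> mA; rewrite /mean /Rintegral integral_indic// setIT. Qed.

Lemma meanD f g : simple f -> simple g ->
  mean (fun x => f x + g x) = mean f + mean g.
Proof.
by move=> sf sg; rewrite /mean RintegralD//; exact: simple_integrable.
Qed.

Lemma meanZ c f : simple f -> mean (fun x => c * f x) = c * mean f.
Proof. by move=> sf; rewrite /mean RintegralZl//; exact: simple_integrable. Qed.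

Lemma mean_cst c : mean (fun=> c) = c.
Proof.
rewrite /mean Rintegral_cst//.
by rewrite [X in _ * X](congr1 fine (probability_setT mu)) mulr1.
Qed.

Lemma mean_sum (I : Type) (s : seq I) (F : I -> Y -> R) :
  (forall i, simple (F i)) ->
  mean (fun x => \sum_(i <- s) F i x) = \sum_(i <- s) mean (F i).
Proof.
move=> sF; elim: s => [|i s ih].
  by under eq_fun do rewrite big_nil; rewrite big_nil mean_cst.
under eq_fun do rewrite big_cons.
by rewrite big_cons meanD ?ih//; exact: simple_sum.
Qed.

Lemma le_mean f g : simple f -> simple g -> (forall x, f x <= g x) ->
  mean f <= mean g.
Proof.
by move=> sf sg fg; apply: le_Rintegral => //; exact: simple_integrable.
Qed.

Lemma mean_ge0 f : (forall x, 0 <= f x) -> 0 <= mean f.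
Proof. by move=> f0; exact: Rintegral_ge0. Qed.

Lemma ler_norm_mean f M : simple f -> (forall x, `|f x| <= M) ->
  `|mean f| <= M.
Proof.
move=> sf fM.
rewrite ler_norml -[X in X <= _]mean_cst -[X in _ && (_ <= X)]mean_cst.
by apply/andP; split; apply: le_mean => //; first [exact: simple_cst |
  move=> x; have := fM x; rewrite ler_norml => /andP[]].
Qed.

End simple_functions.

(** * Multiple mixing along arithmetic progressions *)

Section mixing.
Context {R : realType} d {Y : measurableType d} (mu : probability Y R).
Context (T : Y -> Y).
Hypothesis measT : measurable_fun setT T.
Hypothesis invT : forall A, measurable A -> mu (T @^-1` A) = mu A.
Hypothesis mixT : forall A B, measurable A -> measurable B ->
  cesaro_mean (fun n => `|fine (mu (iter n T @^-1` A `&` B))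
                          - fine (mu A) * fine (mu B)|) @ \oo --> 0.
Implicit Types f g : Y -> R.
Local Notation mean := (mean mu).

Lemma measurable_iter n : measurable_fun setT (iter n T).
Proof.
elim: n => [|n ih]; first exact: measurable_id.
exact: (measurableT_comp measT ih).
Qed.

Lemma simple_iter n f : simple f -> simple (fun x => f (iter n T x)).
Proof. exact/simple_comp/measurable_iter. Qed.

Lemma mean_iter n f : simple f -> mean (fun x => f (iter n T x)) = mean f.
Proof.
have meanT g : simple g -> mean (fun x => g (T x)) = mean g.
  elim=> [A mA|c f1 f2 s1 ih1 s2 ih2].
    rewrite mean_indic// -invT// -mean_indic//.
    by rewrite -[X in measurable X]setTI; exact: measT.
  by rewrite !meanD ?meanZ ?ih1 ?ih2//; try apply: simpleZ;
    try apply: (simple_comp measT).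
move=> sf; elim: n => [//|n ih].
rewrite -[RHS]ih -[RHS](meanT _ (simple_iter n sf)).
by under eq_fun do rewrite iterSr.
Qed.

(** The difference is bilinear in f and g, so it suffices to consider indicators,
    for which this is weak mixing. *)
Lemma mixing_simple f g : simple f -> simple g ->
  cesaro_mean (fun n => `|mean (fun x => f (iter n T x) * g x)
                          - mean f * mean g|) @ \oo --> 0.
Proof.
have simI n (h k : Y -> R) : simple h -> simple k ->
    simple (fun x => h (iter n T x) * k x).
  by move=> sh sk; exact: (simpleM (simple_iter n sh) sk).
move=> sf sg; elim: sf => [A mA|c f1 f2 s1 ih1 s2 ih2]; last first.
  apply: eq_cvg_cesaro_mean (cvg_cesaro_mean_norm_lin c ih1 ih2) => n.
  congr `|_|.
  under [in RHS]eq_fun do rewrite mulrDl -mulrA.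
  rewrite (meanD _ (simpleZ c (simI n _ _ s1 sg)) (simI n _ _ s2 sg)).
  rewrite (meanZ _ _ (simI n _ _ s1 sg)) (meanD _ (simpleZ c s1) s2) meanZ//.
  by ring.
elim: sg => [B mB|c g1 g2 s1 ih1 s2 ih2]; last first.
  have sA := @simple_indic R _ _ _ mA.
  apply: eq_cvg_cesaro_mean (cvg_cesaro_mean_norm_lin c ih1 ih2) => n.
  congr `|_|.
  under [in RHS]eq_fun do rewrite mulrDr mulrCA.
  rewrite (meanD _ (simpleZ c (simI n _ _ sA s1)) (simI n _ _ sA s2)).
  rewrite (meanZ _ _ (simI n _ _ sA s1)) (meanD _ (simpleZ c s1) s2) meanZ//.
  by ring.
apply: eq_cvg_cesaro_mean (mixT mA mB) => n.
rewrite !mean_indic//; congr `|_ - _|; rewrite -mean_indic; last first.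
  apply: measurableI => //; rewrite -[X in measurable X]setTI.
  exact: measurable_iter.
by congr Rintegral; rewrite indicI.
Qed.

(** Convergence is in the sense of Cesaro and along the times n, 2n, ..., kn,
    unlike in the classical notion of mixing of order k. *)
Definition mixing_of_order k := forall f0 (f : nat -> Y -> R),
  simple f0 -> (forall i, simple (f i)) ->
  cesaro_mean (fun n =>
    mean (fun x => f0 x * \prod_(i < k) f i (iter (i.+1 * n) T x))) @ \oo -->
  mean f0 * \prod_(i < k) mean (f i).

(** The inductive step, by van der Corput's inequality for the sequence u_n. The
    induction hypothesis computes the limiting correlations of u_(n+h) and
    u_(n+l) as a product of k+1 factors; all are bounded and the one of index j
    depends only on |h - l| and is small on average. *)
Lemma mixing_zero_mean k f0 (f : nat -> Y -> R) j : mixing_of_order k ->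
  simple f0 -> (forall i, simple (f i)) -> (j < k.+1)%N -> mean (f j) = 0 ->
  cesaro_mean (fun n =>
    mean (fun x => f0 x * \prod_(i < k.+1) f i (iter (i.+1 * n) T x))) @ \oo -->
  0.
Proof.
move=> mixk s0 sf jk fj0.
pose u n x := \prod_(i < k.+1) f i (iter (i.+1 * n) T x).
have su n : simple (u n).
  by apply: simple_prod => i; exact: simple_iter.
pose w (i h l : nat) x := f i (iter (i.+1 * h) T x) * f i (iter (i.+1 * l) T x).
have sw i h l : simple (w i h l) by apply: simpleM; exact: simple_iter.
have [M fM] : exists M, forall (i : 'I_k.+1) x, `|f i x| <= M.
  have [B fB] := choice (fun i => simple_bounded (sf i)).
  exists (\sum_(i < k.+1) B i) => i x; apply: (le_trans (fB i x)).
  rewrite (bigD1 i)//= lerDl sumr_ge0// => l _.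
  exact: le_trans (normr_ge0 _) (fB l x).
have [M0 f0M] := simple_bounded s0.
have uM n x : `|u n x| <= M ^+ k.+1.
  rewrite /u normr_prod -[X in M ^+ X]card_ord -prodr_const.
  by apply: ler_prod => i _; rewrite normr_ge0 fM.
pose phi l := (M * M) ^+ k *
  `|mean (fun x => f j (iter (j.+1 * l) T x) * f j x)|.
have phi_ge0 l : 0 <= phi l by rewrite mulr_ge0// exprn_ge0// -expr2 sqr_ge0.
have mean_wj h l : `|mean (w j h l)| =
    `|mean (fun x => f j (iter (j.+1 * ((h - l) + (l - h))) T x) * f j x)|.
  wlog lh : h l / (l <= h)%N.
    move=> sym; have [/sym//|/ltnW/sym] := leqP l h.
    rewrite addnC => <-; congr `|mean _|; apply/funext => x; exact: mulrC.
  rewrite (eqP lh) addn0 -[in RHS](mean_iter (j.+1 * l)%N); last first.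
    by apply: simpleM => //; exact: simple_iter.
  congr `|mean _|; apply/funext => x.
  by rewrite /= /w -iterD -mulnDr subnK.
pose g h l := \prod_(i < k.+1) mean (w i h l).
apply: (@van_der_corput _ (fun n => mean (fun x => f0 x * u n x))
  (fun n m => mean (fun x => u n x * u m x)) g phi
  (M0 * M ^+ k.+1) (mean (fun x => f0 x * f0 x))) => //.
- by apply: mean_ge0 => x; rewrite -expr2 sqr_ge0.
- move=> n; apply: ler_norm_mean; first exact: (simpleM s0 (su n)).
  by move=> x; rewrite normrM; apply: ler_pM => //; exact: uM.
- move=> e H n.
  (* pointwise this is 0 <= (e f0 - u_n - ... - u_(n+H-1))^2 *)
  have ss : simple (fun x => \sum_(h < H) f0 x * u (n + h)%N x).
    by apply: simple_sum => h; exact: simpleM.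
  have sd (h : 'I_H) :
      simple (fun x => \sum_(l < H) u (n + h)%N x * u (n + l)%N x).
    by apply: simple_sum => l; exact: simpleM.
  have sdd :
      simple (fun x => \sum_(h < H) \sum_(l < H) u (n + h)%N x * u (n + l)%N x).
    exact: simple_sum.
  rewrite -mean_sum; last by move=> h; exact: simpleM.
  under [X in _ <= _ + X]eq_bigr => h _.
    rewrite -mean_sum; last by move=> l; exact: simpleM.
    over.
  rewrite -(mean_sum mu _ sd) -!meanZ//; last exact: simpleM.
  rewrite -meanD//; last by apply: simpleZ; exact: simpleM.
  apply: le_mean => //; [exact: simpleZ| |].
    by apply: simpleD => //; apply: simpleZ; exact: simpleM.
  move=> x; rewrite -mulr_sumr.
  under [X in _ <= _ + X]eq_bigr do rewrite -mulr_sumr.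
  rewrite -mulr_suml -subr_ge0; set S := \sum_(h < H) _.
  rewrite (_ : _ - _ = (e * f0 x - S) ^+ 2) ?sqr_ge0//; ring.
- move=> h l.
  have -> : g h l = mean (w 0%N h l) * \prod_(i < k) mean (w i.+1 h l).
    by rewrite /g big_ord_recl.
  have sw' i : simple (w i.+1 h l) by [].
  apply: eq_cvg_cesaro_mean (mixk _ _ (sw 0%N h l) sw').
  (* invariance under T^n turns T^n, ..., T^((k+1)n) into id, T^n, ..., T^(kn) *)
  move=> n; rewrite -(mean_iter n); last first.
    by apply: simpleM => //; apply: simple_prod => i; exact: simple_iter.
  congr mean; apply/funext => x; rewrite /u -big_split/= big_ord_recl/=.
  congr (_ * _); first by rewrite /w -!iterD !mul1n ![(n + _)%N]addnC.
  by apply: eq_bigr => i _; rewrite /w -!iterD /bump leq0n add1n;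
    congr (f _ (iter _ _ _) * f _ (iter _ _ _)); lia.
- move=> h l; apply: (le_trans (ler_norm _)).
  rewrite /phi -mean_wj /g normr_prod (bigD1 (Ordinal jk))//= mulrC.
  rewrite ler_wpM2r//.
  have -> : (M * M) ^+ k = \prod_(i < k.+1 | i != Ordinal jk) (M * M).
    by rewrite prodr_const cardC1 card_ord.
  apply: ler_prod => i _; rewrite normr_ge0/=; apply: ler_norm_mean => // x.
  by rewrite normrM ler_pM.
- have mix0 : cesaro_mean (fun n =>
      `|mean (fun x => f j (iter n T x) * f j x)|) @ \oo --> 0.
    apply: eq_cvg_cesaro_mean (mixing_simple (sf j) (sf j)) => n.
    by rewrite fj0 mulr0 subr0.
  have dil := @cvg_cesaro_mean_dilate _ _ j (fun=> normr_ge0 _) mix0.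
  rewrite -[X in _ --> X](mulr0 ((M * M) ^+ k)).
  have -> : cesaro_mean phi = fun N => (M * M) ^+ k *
      cesaro_mean (fun l =>
        `|mean (fun x => f j (iter (j.+1 * l) T x) * f j x)|) N.
    by apply/funext => N; rewrite -cesaro_meanZ.
  exact: cvgMl_tmp.
Qed.

(** The functions f i are replaced by their means from left to right;
    each replacement changes the correlation by that of a family with a mean
    zero member, so it does not affect the limit. *)
Theorem weakly_mixing_all_orders k : mixing_of_order k.
Proof.
elim: k => [|k ih] f0 f s0 sf.
  under [X in cesaro_mean X]eq_fun do under eq_fun do rewrite big_ord0 mulr1.
  by rewrite big_ord0 mulr1; exact: cvg_cesaro_mean_cst.
pose F m i : Y -> R := if (i < m)%N then fun=> mean (f i) else f i.
pose corr (g : nat -> Y -> R) n :=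
  mean (fun x => f0 x * \prod_(i < k.+1) g i (iter (i.+1 * n) T x)).
have sF m i : simple (F m i).
  by rewrite /F; case: ifP => // _; exact: simple_cst.
have scorr (g : nat -> Y -> R) n : (forall i, simple (g i)) ->
    simple (fun x => f0 x * \prod_(i < k.+1) g i (iter (i.+1 * n) T x)).
  move=> sg; apply: simpleM => //.
  by apply: simple_prod => i; exact: simple_iter.
have telescope m : (m <= k.+1)%N ->
    cesaro_mean (fun n => corr f n - corr (F m) n) @ \oo --> 0.
  elim: m => [_|m ihm mk].
    by apply: eq_cvg_cesaro_mean (@cvg_cesaro_mean_cst _ 0) => n; rewrite subrr.
  pose Z i : Y -> R := if i == m then fun x => f m x + - mean (f m) else F m i.
  have sZ i : simple (Z i).
    by rewrite /Z; case: ifP => // _; apply: simpleD => //; exact: simple_cst.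
  have Zm0 : mean (Z m) = 0.
    by rewrite /Z eqxx meanD ?mean_cst ?subrr//; exact: simple_cst.
  have := cvg_cesaro_meanD (ihm (ltnW mk)) (mixing_zero_mean ih s0 sZ mk Zm0).
  rewrite addr0.
  apply: eq_cvg_cesaro_mean => n; rewrite -/(corr Z n).
  suff -> : corr (F m) n = corr (F m.+1) n + corr Z n.
    by rewrite opprD addrA subrK.
  rewrite /corr -meanD; [|exact: scorr|exact: scorr].
  congr Rintegral; apply/funext => x.
  rewrite -mulrDr; congr (_ * _); pose j := Ordinal mk.
  rewrite [LHS](bigD1 j)// [X in _ = X + _](bigD1 j)//.
  rewrite [X in _ = _ + X](bigD1 j)//=.
  rewrite /F /Z ltnn ltnSn eqxx.
  set p1 := \prod_(i < k.+1 | _) _; set p2 := \prod_(i < k.+1 | _) _.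
  set p3 := \prod_(i < k.+1 | _) _.
  have neq_m (i : 'I_k.+1) : i != j -> (i == m :> nat) = false by move/negbTE.
  have -> : p2 = p1.
    by apply: eq_bigr => i /neq_m im; rewrite ltnS leq_eqVlt im.
  have -> : p3 = p1 by apply: eq_bigr => i /neq_m ->.
  by rewrite mulrDl mulNr addrC subrK.
have corrF n : corr (F k.+1) n = mean f0 * \prod_(i < k.+1) mean (f i).
  rewrite /corr mulrC -meanZ//; congr Rintegral; apply/funext => x.
  by rewrite mulrC; congr (_ * _); apply: eq_bigr => i _; rewrite /F ltn_ord.
have := cvg_cesaro_meanD (telescope _ (leqnn _))
  (@cvg_cesaro_mean_cst _ (mean f0 * \prod_(i < k.+1) mean (f i))).
rewrite add0r.
by apply: eq_cvg_cesaro_mean => n; rewrite corrF subrK.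
Qed.

(** * Pointwise recurrence *)

Definition joint_visit k (U : nat -> set Y) (x : Y) (n : nat) : R :=
  \prod_(i < k) \1_(U i) (iter (i.+1 * n) T x).

(** For fixed K the points with K as witness form a set E on which the averages
    of joint visits are at most delta from time K on. Multiple mixing applied to
    the indicator of E and those of the U i gives
    mu(E) * prod_i mu(U i) <= mu(E) * delta, which forces mu(E) = 0. *)
Lemma negligible_rare_visits k (U : nat -> set Y) (delta : R) :
  (forall i, measurable (U i)) -> delta < \prod_(i < k) fine (mu (U i)) ->
  mu.-negligible [set x | exists K, forall N, (K <= N)%N ->
                          cesaro_mean (joint_visit k U x) N <= delta].
Proof.
move=> mU deltac.
pose E K := \bigcap_(N in [set N | (K <= N)%N])
  ((fun x => cesaro_mean (joint_visit k U x) N) @^-1` `]-oo, delta]).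
suff negE K : mu.-negligible (E K).
  apply: negligibleS (negligible_bigcup negE) => x [K EK].
  by exists K => // N KN /=; rewrite in_itv/= EK.
have svisit n : simple (fun x => joint_visit k U x n).
  by apply: simple_prod => i; apply: simple_iter => //; exact: simple_indic.
have savg N : simple (fun x => cesaro_mean (joint_visit k U x) N).
  by apply: simpleZ; exact: simple_sum.
have mE : measurable (E K).
  apply: bigcap_measurableType => N _.
  rewrite -[X in measurable X]setTI; apply: (simple_measurable (savg N)) => //.
apply/negligibleP => //.
have sE : simple (\1_(E K) : Y -> R) by exact: simple_indic.
have lim : cesaro_mean (fun n =>
    mean (fun x => \1_(E K) x * joint_visit k U x n))
    @ \oo --> fine (mu (E K)) * \prod_(i < k) fine (mu (U i)).
  have := @weakly_mixing_all_orders k \1_(E K) (fun i => \1_(U i)) sE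
    (fun i => simple_indic (mU i)).
  rewrite mean_indic//; under eq_bigr do rewrite mean_indic//.
  exact.
have bound : fine (mu (E K)) * \prod_(i < k) fine (mu (U i)) <=
    fine (mu (E K)) * delta.
  apply: (ler_cvg_to lim (cvg_cst _)); exists K => // N /= KN.
  rewrite /cesaro_mean -mean_sum; last by move=> n; exact: simpleM.
  rewrite -meanZ; last by apply: simple_sum => n; exact: simpleM.
  rewrite -mean_indic// mulrC -meanZ//; apply: le_mean.
  - by apply: simpleZ; apply: simple_sum => n; exact: simpleM.
  - exact: simpleZ.
  move=> x; rewrite -mulr_sumr mulrCA mulrC indicE.
  have [xE|_] := boolP (x \in E K); last by rewrite !mulr0.
  by rewrite !mulr1; move: xE; rewrite inE => /(_ N KN)/=; rewrite in_itv.
have : fine (mu (E K)) <= 0.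
  rewrite leNgt; apply/negP => E0; move: bound.
  by rewrite ler_pM2l// leNgt deltac.
rewrite -lee_fin fineK ?fin_num_measure// => mu0.
by apply/eqP; rewrite eq_le mu0 measure_ge0.
Qed.

End mixing.

(** * Open sets of a compact metric space *)

Section topology.
Context {R : realType} {X : pmetricType R}.

Lemma open_borel (U : set X) : open U -> measurable (U : set (borel X)).
Proof. exact: sub_sigma_algebra. Qed.

Lemma continuous_borel (T : X -> X) : continuous T ->
  measurable_fun setT (T : borel X -> borel X).
Proof.
move=> /continuousP cT.
apply: (@measurability _ _ (borel X) (borel X) setT T (@open X)) => //.
move=> _ [U oU <-].
by rewrite setTI; apply: open_borel; exact: cT.
Qed.

Lemma fully_supported_gt0 (mu : probability (borel X) R) (U : set X) :
  fully_supported mu -> open U -> U !=set0 -> 0 < fine (mu U).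
Proof.
move=> supp oU [x Ux]; rewrite lt_neqAle fine_ge0 ?andbT ?measure_ge0//.
apply/negP => /eqP mU0; have : measure_support mu x by rewrite supp.
move=> /(_ (~` U)); apply => //; split; first exact: open_closedC.
have := probability_setC mu (open_borel oU).
move=> ->; rewrite -[mu U]fineK; last first.
  by apply: fin_num_measure; exact: open_borel.
by rewrite -mU0 sube0.
Qed.

Lemma compact_countable_basis : compact [set: X] -> exists V : nat -> set X,
  (forall n, open (V n)) /\
  forall U, open U -> U !=set0 -> exists n, V n !=set0 /\ V n `<=` U.
Proof.
move=> /compact_second_countable [B cB [Bo Bb]].
have /pfcard_geP [B0|[f]] := cB.
  by have [W [+ _] _] := Bb point setT filterT; rewrite B0.
exists f; split=> [n|U oU [x Ux]]; first by apply: Bo; exact: funS.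
have [W [BW Wx] WU] := Bb x U (open_nbhs_nbhs (conj oU Ux)).
have [n _ fn] : (f @` setT) W by exact: surj.
by exists n; rewrite fn; split => //; exists x.
Qed.

End topology.

(** * Positive upper density *)

Lemma upper_density_gt0 (R : realType) (F : set nat) (c : R) : 0 < c ->
  (forall K, exists2 N, (K <= N)%N &
     c <= #|[pred n : 'I_N | (n : nat) \in F]|%:R / N%:R) ->
  (0 < upper_density R F)%E.
Proof.
move=> c0 Fc; rewrite /upper_density limn_esup_lim.
apply: (@lt_le_trans _ _ c%:E); first by rewrite lte_fin.
apply: lime_ge; first exact: is_cvg_esups.
apply: nearW => K; have [N KN cN] := Fc K.
apply: (@le_trans _ _ (#|[pred n : 'I_N | (n : nat) \in F]|%:R / N%:R)%:E).
  by rewrite lee_fin.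
by apply: ereal_sup_ubound; exists N.
Qed.

Lemma iter_prod_powers (X : Type) (T : X -> X) d (z : 'I_d -> X) n i :
  iter n (@prod_powers X T d) z i = iter (i.+1 * n) T (z i).
Proof.
elim: n => [|n ih]; first by rewrite muln0.
by rewrite iterS {1}/prod_powers ih -iterD mulnS.
Qed.

(** The 1 accounts for n = 0, which may be a joint visit but is never a return
    time. *)
Lemma joint_visit_le_return (R : realType) (X : pmetricType R) (T : X -> X) k
    (V : nat -> set X) (U : 'I_k -> set X) (x : X) N :
  (forall i : 'I_k, V i `<=` U i) ->
  \sum_(n < N) joint_visit (R := R) (Y := borel X) T k V x n <=
  1 + #|[pred n : 'I_N | (n : nat) \in
          return_times (@prod_powers X T k) (fun=> x) (box U)]|%:R.
Proof.
move=> VU; set F := return_times _ _ _.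
have visit_le n : joint_visit (R := R) (Y := borel X) T k V x n <=
    (n == 0%N)%:R + (n \in F)%:R.
  have [->|n0] := eqVneq n 0%N.
    rewrite -[leLHS]addr0 lerD// /joint_visit.
    by apply: prodr_ile1 => i _; rewrite indicE ler0n lern1 leq_b1.
  rewrite add0r; have [nF|nF] := boolP (n \in F).
    by apply: prodr_ile1 => i _; rewrite indicE ler0n lern1 leq_b1.
  suff [i Vi] : exists i : 'I_k, ~ V i (iter (i.+1 * n) T x).
    by rewrite /joint_visit (bigD1 i)//= indicE memNset// mul0r.
  apply: contrapT => nV; move/negP : nF; apply; rewrite inE; split.
    by rewrite lt0n.
  move=> i; rewrite iter_prod_powers; apply: VU; apply: contrapT => Vi.
  by apply: nV; exists i.
apply: (le_trans (ler_sum _ (fun (n : 'I_N) _ => visit_le n))).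
rewrite big_split/= lerD//.
  case: N => [|N]; first by rewrite big_ord0.
  by rewrite big_ord_recl big1 ?addr0.
by rewrite -natr_sum -sum1_card [in leRHS]big_mkcond.
Qed.

Theorem theorem3p18 (R : realType) (X : pmetricType R) (T : X -> X)
    (cptX : compact [set: X]) (ctsT : continuous T)
    (mu : probability (borel X) R) (invT : invariant_measure T mu)
    (wmT : weakly_mixing T mu) (suppT : fully_supported mu) :
  exists X0 : set (borel X),
    [/\ measurable X0, mu X0 = 1%E &
        forall x : X, X0 x ->
        forall d : nat, (0 < d)%N ->
        forall U : 'I_d -> set X,
          (forall i, open (U i)) -> (forall i, U i !=set0) ->
          (0 < upper_density R
                 (return_times (@prod_powers X T d) (fun=> x) (box U)))%E].
Proof.
have [V [oV basisV]] := compact_countable_basis cptX.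
have mV n := open_borel (oV n).
pose W (s : seq nat) i : set (borel X) := V (nth 0%N s i).
pose c (s : seq nat) := \prod_(i < size s) fine (mu (W s i)).
pose rare s := [set x : borel X | exists K, forall N, (K <= N)%N ->
  cesaro_mean (joint_visit (R := R) (Y := borel X) T (size s) (W s) x) N
    <= c s / 2].
have negl_rare s : 0 < c s -> mu.-negligible (rare s).
  move=> c0; apply: negligible_rare_visits => //.
  - exact: continuous_borel.
  - by move=> i; exact: mV.
  - by rewrite -/(c s); lra.
(* finite lists of indices into the basis, enumerated by n *)
pose F n := if unpickle n is Some s then
  if 0 < c s then rare s else set0 else set0.
have [A [mA A0 FA]] : mu.-negligible (\bigcup_n F n).
  apply: negligible_bigcup => n; rewrite /F.
  case: unpickle => [s|]; last exact: negligible_set0.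
  by case: ifPn => [/negl_rare//|_]; exact: negligible_set0.
exists (~` A); split; first exact: measurableC.
  have := probability_setC mu mA.
  by move=> ->; have -> : mu A = 0%E := A0; rewrite sube0.
move=> x nAx k _ U oU U0.
have [idx idxP] := choice (fun i => basisV (U i) (oU i) (U0 i)).
pose s := [seq idx i | i <- enum 'I_k].
have size_s : size s = k by rewrite size_map size_enum_ord.
have nth_s (i : 'I_k) : nth 0%N s i = idx i.
  by rewrite (nth_map i) ?size_enum_ord// nth_ord_enum.
have c0 : 0 < c s.
  rewrite /c size_s prodr_gt0// => i _; rewrite /W nth_s.
  by apply: fully_supported_gt0 => //; have [] := idxP i.
have often K : exists2 N, (K <= N)%N &
    c s / 2 < cesaro_mean (joint_visit (R := R) (Y := borel X) T k (W s) x) N.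
  apply: contrapT => nK; apply: nAx; apply: FA.
  exists (pickle s) => //; rewrite /F pickleK c0; exists K => N KN.
  rewrite size_s leNgt; apply/negP => cN; apply: nK; by exists N.
(* from K0 on, the visit at time 0 contributes less than c s / 4 *)
have [K0 _ K0P] : \forall N \near \oo, N%:R^-1 < c s / 4.
  by apply: (cvgr_lt _ (@cvg_inv_nat R)); rewrite divr_gt0.
apply: (@upper_density_gt0 _ _ (c s / 4)); first by rewrite divr_gt0.
move=> K; have [N KN cN] := often (maxn K K0).
move: KN; rewrite geq_max => /andP[KN K0N]; exists N => //.
have := @joint_visit_le_return R X T k (W s) U x N.
have VU (i : 'I_k) : W s i `<=` U i by rewrite /W nth_s; have [] := idxP i.
move=> /(_ VU) sumle.
have Ninv : (0 : R) <= N%:R^-1 by rewrite invr_ge0.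
have := ler_wpM2l Ninv sumle; move: cN (K0P _ K0N).
rewrite /cesaro_mean mulrDr mulr1 [_ / N%:R]mulrC /=; lra.
Qed.
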